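(* A pair $\left(\frac ab,\frac cd\right)\in\mathbb{Q}^2$ of rationals in reduced form is inner (resp. outer) regular if and only if there exists an orientation-preserving (resp. orientation-reversing) involution in $\mathrm{PGL}_2(\mathbb{Z})$ exchanging $\frac ab$ with $\frac cd$.
   Context: With $d_F=|ad-bc|$, the pair is inner regular if $\gcd(ab+cd,b^2+d^2,a^2+c^2)=d_F$, and outer regular if $\gcd(ab-cd,b^2-d^2,a^2-c^2)=d_F$ (with $\gcd(0,0,0)=0$). $\mathrm{PGL}_2(\mathbb{Z})$ acts on $\mathbb{Q}\cup\{\infty\}$ by Möbius transformations, and on the upper half-plane $\mathbb{H}^2$ by isometries: a matrix $\begin{pmatrix}\alpha&\beta\\\gamma&\delta\end{pmatrix}$ acts by $z\mapsto\frac{\alpha z+\beta}{\gamma z+\delta}$ if its determinant is $1$ (orientation-preserving) and by $z\mapsto\frac{\alpha\bar z+\beta}{\gamma\bar z+\delta}$ if its determinant is $-1$ (orientation-reversing). An involution is an element of order exactly $2$. *)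

(* Defs.v *)
From HB Require Import structures.
From mathcomp Require Import all_boot all_order all_algebra.
Set Implicit Arguments.
Unset Strict Implicit.
Unset Printing Implicit Defensive.

Import GRing.Theory Num.Theory.
Local Open Scope ring_scope.
Local Open Scope quotient_scope.

Record GL2Z := MkGL2Z { GL2Z_mx : 'M[int]_2; _ : GL2Z_mx \in unitmx }.

HB.instance Definition _ := [isSub for GL2Z_mx].
HB.instance Definition _ := [Choice of GL2Z by <:].

Fact GL2Z_one_subproof : (1%:M : 'M[int]_2) \in unitmx.
Proof. exact: unitmx1. Qed.

Fact GL2Z_mul_subproof (A B : GL2Z) : (val A *m val B) \in unitmx.
Proof. by rewrite unitmx_mul (valP A) (valP B). Qed.

Fact GL2Z_inv_subproof (A : GL2Z) : invmx (val A) \in unitmx.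
Proof. by rewrite unitmx_inv (valP A). Qed.

Fact GL2Z_opp_subproof (A : GL2Z) : - val A \in unitmx.
Proof. by rewrite -scaleN1r unitmxZ ?(valP A) // unitrN1. Qed.

Definition GL2Z_one : GL2Z := MkGL2Z GL2Z_one_subproof.
Definition GL2Z_mul (A B : GL2Z) : GL2Z := MkGL2Z (GL2Z_mul_subproof A B).
Definition GL2Z_inv (A : GL2Z) : GL2Z := MkGL2Z (GL2Z_inv_subproof A).
Definition GL2Z_opp (A : GL2Z) : GL2Z := MkGL2Z (GL2Z_opp_subproof A).

Fact GL2Z_mulA : associative GL2Z_mul.
Proof. by move=> A B C; apply: val_inj; rewrite /= mulmxA. Qed.

Fact GL2Z_mul1 : left_id GL2Z_one GL2Z_mul.
Proof. by move=> A; apply: val_inj; rewrite /= mul1mx. Qed.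

Fact GL2Z_mulr1 : right_id GL2Z_one GL2Z_mul.
Proof. by move=> A; apply: val_inj; rewrite /= mulmx1. Qed.

Fact GL2Z_mulV : left_inverse GL2Z_one GL2Z_inv GL2Z_mul.
Proof. by move=> A; apply: val_inj; rewrite /= mulVmx ?(valP A). Qed.

Fact GL2Z_mulrV : right_inverse GL2Z_one GL2Z_inv GL2Z_mul.
Proof. by move=> A; apply: val_inj; rewrite /= mulmxV ?(valP A). Qed.

HB.instance Definition _ := isGroup.Build GL2Z
  GL2Z_mulA GL2Z_mul1 GL2Z_mulr1 GL2Z_mulV GL2Z_mulrV.

(* The units of int are 1 and -1, so the invertible scalar matrices, by which
   GL_2(Z) is to be quotiented, are 1 and -1. *)
Definition pgl_eqv : rel GL2Z := fun A B => (A == B) || (A == GL2Z_opp B).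

Fact GL2Z_oppK : involutive GL2Z_opp.
Proof. by move=> A; apply: val_inj; rewrite /= opprK. Qed.

Fact pgl_eqv_refl : reflexive pgl_eqv.
Proof. by move=> A; rewrite /pgl_eqv eqxx. Qed.

Fact pgl_eqv_sym : symmetric pgl_eqv.
Proof.
move=> A B; rewrite /pgl_eqv eq_sym; congr (_ || _).
by apply/eqP/eqP => ->; rewrite GL2Z_oppK.
Qed.

Fact pgl_eqv_trans : transitive pgl_eqv.
Proof.
move=> B A C; rewrite /pgl_eqv.
by case/orP=> /eqP-> /orP[]/eqP->; rewrite ?GL2Z_oppK eqxx ?orbT.
Qed.

Canonical pgl_eqv_equiv := EquivRel pgl_eqv
  pgl_eqv_refl pgl_eqv_sym pgl_eqv_trans.

Definition PGL2Z := {eq_quot pgl_eqv}.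
HB.instance Definition _ := Choice.on PGL2Z.
HB.instance Definition _ := EqQuotient.on PGL2Z.

Definition PGL2Z_one : PGL2Z := \pi_PGL2Z GL2Z_one.
Definition PGL2Z_mul (g h : PGL2Z) : PGL2Z :=
  \pi_PGL2Z (GL2Z_mul (repr g) (repr h)).
Definition PGL2Z_inv (g : PGL2Z) : PGL2Z := \pi_PGL2Z (GL2Z_inv (repr g)).

Lemma pgl_piP (A B : GL2Z) :
  reflect (\pi_PGL2Z A = \pi_PGL2Z B) (pgl_eqv A B).
Proof. by apply: (iffP idP) => [AB|/eqP]; [apply/eqP|]; rewrite piE. Qed.

Variant pgl_repr_spec (A : GL2Z) : GL2Z -> Type :=
  | PglReprId : pgl_repr_spec A A
  | PglReprOpp : pgl_repr_spec A (GL2Z_opp A).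

Lemma pgl_reprP (A : GL2Z) : pgl_repr_spec A (repr (\pi_PGL2Z A)).
Proof.
have /pgl_piP := reprK (\pi_PGL2Z A).
by rewrite /pgl_eqv; have [->|_ /= /eqP->] := eqVneq; constructor.
Qed.

Lemma PGL2Z_oppE (A : GL2Z) : \pi_PGL2Z (GL2Z_opp A) = \pi_PGL2Z A.
Proof. by apply/pgl_piP; rewrite /pgl_eqv eqxx orbT. Qed.

Fact GL2Z_mulN (A B : GL2Z) : GL2Z_mul A (GL2Z_opp B) = GL2Z_opp (GL2Z_mul A B).
Proof. by apply: val_inj; rewrite /= mulmxN. Qed.

Fact GL2Z_mulNl (A B : GL2Z) :
  GL2Z_mul (GL2Z_opp A) B = GL2Z_opp (GL2Z_mul A B).
Proof. by apply: val_inj; rewrite /= mulNmx. Qed.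

Lemma PGL2Z_mulE (A B : GL2Z) :
  PGL2Z_mul (\pi_PGL2Z A) (\pi_PGL2Z B) = \pi_PGL2Z (GL2Z_mul A B).
Proof.
rewrite /PGL2Z_mul.
by case: pgl_reprP; case: pgl_reprP;
  rewrite ?(GL2Z_mulN, GL2Z_mulNl, PGL2Z_oppE).
Qed.

Lemma PGL2Z_ind (P : PGL2Z -> Prop) : (forall A, P (\pi_PGL2Z A)) -> forall g, P g.
Proof. by move=> PA g; rewrite -[g]reprK. Qed.

Fact PGL2Z_mulA : associative PGL2Z_mul.
Proof.
elim/PGL2Z_ind=> A; elim/PGL2Z_ind=> B; elim/PGL2Z_ind=> C.
by rewrite !PGL2Z_mulE GL2Z_mulA.
Qed.

Fact PGL2Z_mul1 : left_id PGL2Z_one PGL2Z_mul.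
Proof. by elim/PGL2Z_ind=> A; rewrite PGL2Z_mulE GL2Z_mul1. Qed.

Fact PGL2Z_mulr1 : right_id PGL2Z_one PGL2Z_mul.
Proof. by elim/PGL2Z_ind=> A; rewrite PGL2Z_mulE GL2Z_mulr1. Qed.

Fact PGL2Z_mulV : left_inverse PGL2Z_one PGL2Z_inv PGL2Z_mul.
Proof.
by move=> g; rewrite -{2}[g]reprK PGL2Z_mulE GL2Z_mulV.
Qed.

Fact PGL2Z_mulrV : right_inverse PGL2Z_one PGL2Z_inv PGL2Z_mul.
Proof.
by move=> g; rewrite -{1}[g]reprK PGL2Z_mulE GL2Z_mulrV.
Qed.

HB.instance Definition _ := isGroup.Build PGL2Z
  PGL2Z_mulA PGL2Z_mul1 PGL2Z_mulr1 PGL2Z_mulV PGL2Z_mulrV.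

(* Well defined on PGL_2(Z) because \det (- A) = \det A in even dimension. *)
Definition PGL2Z_det (g : PGL2Z) : int := \det (val (repr g)).

Lemma PGL2Z_detE (A : GL2Z) : PGL2Z_det (\pi_PGL2Z A) = \det (val A).
Proof.
rewrite /PGL2Z_det; case: pgl_reprP => //=.
by rewrite -scaleN1r detZ sqrrN expr1n mul1r.
Qed.

(* An element of PGL_2(Z) acts on the upper half-plane holomorphically if its
   determinant is 1 and antiholomorphically if its determinant is -1. *)
Definition orientation_preserving (g : PGL2Z) : Prop := PGL2Z_det g = 1.
Definition orientation_reversing (g : PGL2Z) : Prop := PGL2Z_det g = -1.

Definition involution (g : PGL2Z) : Prop := g <> 1%g /\ (g ^+ 2)%g = 1%g.

(* option rat stands for the projective line over rat, with None the point at
   infinity. *)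
Definition moebius (A : 'M[int]_2) (x : option rat) : option rat :=
  let alpha := (A 0 0)%:~R in let beta := (A 0 1)%:~R in
  let gamma := (A 1 0)%:~R in let delta := (A 1 1)%:~R in
  match x with
  | Some q => if gamma * q + delta == 0 then None
              else Some ((alpha * q + beta) / (gamma * q + delta))
  | None => if gamma == 0 then None else Some (alpha / gamma)
  end.

Lemma moebiusN (A : 'M[int]_2) (x : option rat) : moebius (- A) x = moebius A x.
Proof.
rewrite /moebius !mxE !mulrNz; case: x => [q|]; last first.
  by rewrite oppr_eq0 invrN mulrNN.
by rewrite !mulNr -!opprD oppr_eq0 invrN mulrNN.
Qed.

Definition PGL2Z_act (g : PGL2Z) (x : option rat) : option rat :=
  moebius (val (repr g)) x.

Lemma PGL2Z_actE (A : GL2Z) (x : option rat) :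
  PGL2Z_act (\pi_PGL2Z A) x = moebius (val A) x.
Proof. by rewrite /PGL2Z_act; case: pgl_reprP => //=; rewrite moebiusN. Qed.

Definition exchanges (g : PGL2Z) (x y : rat) : Prop :=
  PGL2Z_act g (Some x) = Some y /\ PGL2Z_act g (Some y) = Some x.

(* The denominator may be negative. *)
Definition reduced_form (a b : int) : Prop := b != 0 /\ coprimez a b.

Definition fraction (a b : int) : rat := a%:~R / b%:~R.

Definition gcdz3 (x y z : int) : int := gcdz (gcdz x y) z.

Definition farey_dist (a b c d : int) : int := `|a * d - b * c|.

Definition inner_regular (a b c d : int) : Prop :=
  gcdz3 (a * b + c * d) (b ^+ 2 + d ^+ 2) (a ^+ 2 + c ^+ 2)
  = farey_dist a b c d.

Definition outer_regular (a b c d : int) : Prop :=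
  gcdz3 (a * b - c * d) (b ^+ 2 - d ^+ 2) (a ^+ 2 - c ^+ 2)
  = farey_dist a b c d.

(* Main.v *)
Require Import Defs.
From mathcomp Require Import all_boot all_order all_algebra ring zify.

(** Write v = (a, b) and w = (c, d) for the primitive integer vectors above the
two fractions, and D = ad - bc.  Both equivalences are the cases s = 1 and
s = -1 of one statement about matrices of determinant s.

An element of PGL_2(Z) is an involution exactly when its matrices have trace
zero ([involution_trace], by Cayley-Hamilton), and A exchanges the two fractions
exactly when A v = k w and A w = l v for some nonzero integers k and l
([moebius_fraction]; k and l are integers because the fractions are reduced).  So
the question is which v and w admit an integer matrix A of determinant s and
trace zero with these properties ([traceless_swap]).

As A^2 = -s, one gets kl = -s, so that k and l are units.  If D is nonzero, A is
then determined up to sign, being prescribed on a basis of Q^2, and it is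

<<
    1/D * [ ab + s cd    -(a^2 + s c^2) ]
          [ b^2 + s d^2  -(ab + s cd)   ].
>>

Hence A exists over the integers if and only if D divides the three numbers
ab + s cd, b^2 + s d^2 and a^2 + s c^2, that is, divides their gcd.  The
rational matrix above always has determinant s, i.e. (ab + s cd)^2 differs from
(b^2 + s d^2) (a^2 + s c^2) by -s D^2; therefore the gcd always divides D, and D
divides it exactly when it equals |D| ([regular_dvdz]), which is regularity.

If D = 0 the fractions coincide.  Divisibility by 0 forces b^2 + s d^2 = 0, so
s = -1, and a reflection fixing the line of v always exists
([traceless_reflection]).  In the other direction D = 0 is not special: the three
divisibilities are read off A without dividing by D, and for s = 1 they express
that an involution of determinant 1 fixes no rational point. *)

Import GRing.Theory Num.Theory.
Local Open Scope ring_scope.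
Local Open Scope quotient_scope.

(** * Two by two integer matrices *)

Definition mx22 (x y z t : int) : 'M[int]_2 :=
  \matrix_(i, j) if i == 0 then (if j == 0 then x else y)
                 else (if j == 0 then z else t).

Lemma ord2_eq01 (i : 'I_2) : i = 0 \/ i = 1.
Proof. by case: i => [[|[|//]] ?]; [left | right]; apply: val_inj. Qed.

Lemma mx22E (A : 'M[int]_2) : A = mx22 (A 0 0) (A 0 1) (A 1 0) (A 1 1).
Proof.
apply/matrixP=> i j; rewrite mxE.
by case: (ord2_eq01 i) => ->; case: (ord2_eq01 j) => ->.
Qed.

Lemma mx22_eq x y z t x' y' z' t' :
  mx22 x y z t = mx22 x' y' z' t' <-> [/\ x = x', y = y', z = z' & t = t'].
Proof.
split=> [/matrixP e|[-> -> -> ->] //].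
by move: (e 0 0) (e 0 1) (e 1 0) (e 1 1); rewrite !mxE.
Qed.

Lemma det_mx22 x y z t : \det (mx22 x y z t) = x * t - y * z.
Proof.
rewrite (expand_det_row _ 0) !big_ord_recl big_ord0 /cofactor !det_mx11 !mxE /=.
ring.
Qed.

Lemma mxtrace_mx22 x y z t : \tr (mx22 x y z t) = x + t.
Proof. by rewrite /mxtrace !big_ord_recl big_ord0 !mxE /= addr0. Qed.

Lemma mulmx22 x y z t x' y' z' t' :
  mx22 x y z t *m mx22 x' y' z' t' =
  mx22 (x * x' + y * z') (x * y' + y * t') (z * x' + t * z') (z * y' + t * t').
Proof.
apply/matrixP=> i j; rewrite !mxE !big_ord_recl big_ord0 !mxE /= addr0.
by case: (ord2_eq01 i) => ->; case: (ord2_eq01 j) => ->.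
Qed.

Lemma scalar_mx22 x : x%:M = mx22 x 0 0 x.
Proof.
apply/matrixP=> i j; rewrite !mxE.
by case: (ord2_eq01 i) => ->; case: (ord2_eq01 j) => ->.
Qed.

(** * Involutions and their action on fractions *)

Lemma det_GL2Z (A : GL2Z) : \det (val A) = 1 \/ \det (val A) = -1.
Proof.
by have := valP A; rewrite unitmxE qualifE /= => /orP[]/eqP; [left|right].
Qed.

(** By Cayley-Hamilton A^2 = (tr A) A - det A.  If tr A = 0, then A^2 is a
scalar and A is not; if tr A is nonzero and A^2 is a scalar, then so is A, and
A is trivial in PGL_2(Z). *)
Lemma involution_trace (A : GL2Z) :
  involution (\pi_PGL2Z A) <-> \tr (val A) = 0.
Proof.
have pi1 (B : GL2Z) :
  \pi_PGL2Z B = 1%g <-> val B = 1%:M \/ val B = (-1)%:M.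
  rewrite -[1%:M]/(val GL2Z_one).
  have -> : (-1)%:M = val (GL2Z_opp GL2Z_one) :> 'M[int]_2.
    by rewrite /= raddfN.
  split=> [/pgl_piP/orP[]/eqP->|[]/val_inj->]; [by left|by right|by []|].
  exact: PGL2Z_oppE.
rewrite /involution expgS expg1 -[(_ * _)%g]/(PGL2Z_mul _ _) PGL2Z_mulE !pi1.
rewrite -[val (GL2Z_mul A A)]/(val A *m val A).
move: (val A) (det_GL2Z A) => B; rewrite [B]mx22E.
move: (B 0 0) (B 0 1) (B 1 0) (B 1 1) => x y z t.
rewrite det_mx22 mxtrace_mx22 !mulmx22 !scalar_mx22 !mx22_eq => detA.
split=> [[nA1 sqA] | trA].
  (* The off-diagonal entries of A^2 and the difference of its diagonal entries
     are all multiples of the trace x + t. *)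
  have [y0 z0] : y * (x + t) = 0 /\ z * (x + t) = 0.
    by case: sqA => -[_ y0 z0 _]; (split; [rewrite -y0 | rewrite -z0]); ring.
  apply/eqP; apply: contra_notT nA1 => trN0.
  have {}y0 : y = 0 by apply: (mulIf trN0); rewrite y0 mul0r.
  have {}z0 : z = 0 by apply: (mulIf trN0); rewrite z0 mul0r.
  have xt : x = t.
    apply/eqP; rewrite -subr_eq0; apply/eqP/(mulIf trN0); rewrite mul0r.
    transitivity ((x * x + y * z) - (z * y + t * t)); first by ring.
    by case: sqA => -[-> _ _ ->]; rewrite subrr.
  have /eqP : x ^+ 2 = 1 by move: detA; rewrite y0 -xt expr2; nia.
  by rewrite sqrf_eq1 => /orP[]/eqP xE; [left|right]; split; rewrite -?xt.
have tE : t = - x by lia.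
split; first by case=> -[]; lia.
rewrite tE in detA *.
case: detA => dA; [right|left]; split; try ring.
all: apply: oppr_inj; rewrite ?opprK -dA; ring.
Qed.

Definition maps_to_multiple (A : 'M[int]_2) (a b c d k : int) : Prop :=
  A 0 0 * a + A 0 1 * b = k * c /\ A 1 0 * a + A 1 1 * b = k * d.

(** Equality of fractions only says that A (a, b) is a rational multiple of
(c, d); the multiple is an integer because (c, d) is primitive. *)
Lemma moebius_fraction (A : 'M[int]_2) a b c d :
  b != 0 -> reduced_form c d ->
  (moebius A (Some (fraction a b)) = Some (fraction c d) <->
   exists2 k, k != 0 & maps_to_multiple A a b c d k).
Proof.
move=> b0 [d0 cop]; rewrite /moebius /fraction /maps_to_multiple.
move: (A 0 0) (A 0 1) (A 1 0) (A 1 1) => x y z t.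
have bQ : b%:~R != 0 :> rat by rewrite intr_eq0.
have dQ : d%:~R != 0 :> rat by rewrite intr_eq0.
have lin u v : u%:~R * (a%:~R / b%:~R) + v%:~R
             = (u * a + v * b)%:~R / b%:~R :> rat.
  by rewrite rmorphD !rmorphM /=; field.
rewrite !lin mulf_eq0 invr_eq0 (negPf bQ) orbF intr_eq0.
rewrite -mulf_div divff ?invr_eq0 // mulr1.
have [-> | D0] := eqVneq (z * a + t * b) 0.
  split=> [// | [k k0 [_ /esym/eqP]]].
  by rewrite mulf_eq0 (negPf k0) (negPf d0).
have DQ : (z * a + t * b)%:~R != 0 :> rat by rewrite intr_eq0.
split=> [[/eqP] | [k k0 [N D]]].
  rewrite eqr_div // -!rmorphM eqr_int /= => /eqP N.
  have : (d %| z * a + t * b)%Z.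
    rewrite -(@Gauss_dvdzr d c) 1?coprimez_sym // -N.
    exact: dvdz_mull.
  case/dvdzP=> k D; exists k.
    by apply: contraNneq D0 => k0; rewrite D k0 mul0r.
  by split=> //; apply: (mulIf d0); rewrite N D; ring.
congr Some; apply/eqP; rewrite eqr_div // -!rmorphM eqr_int N D /=.
by apply/eqP; ring.
Qed.

(** * Regularity as divisibility *)

(** The case s = 1 is inner regularity, and s = -1 is outer regularity. *)
Definition regular (s a b c d : int) : Prop :=
  gcdz3 (a * b + s * (c * d)) (b ^+ 2 + s * d ^+ 2) (a ^+ 2 + s * c ^+ 2)
  = farey_dist a b c d.

(** With p, q, r the three arguments of the gcd, g the gcd itself and
D = ad - bc, one has q r - p^2 = s D^2.  Thus g^2 divides D^2, so g divides D,
and g = |D| as soon as D divides g. *)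
Lemma regular_dvdz s a b c d : s ^+ 2 = 1 ->
  (regular s a b c d <->
   [/\ (a * d - b * c %| a * b + s * (c * d))%Z,
       (a * d - b * c %| b ^+ 2 + s * d ^+ 2)%Z
     & (a * d - b * c %| a ^+ 2 + s * c ^+ 2)%Z]).
Proof.
move=> s2; rewrite /regular /farey_dist /gcdz3.
set D := a * d - b * c; set p := _ + s * (c * d).
set q := b ^+ 2 + _; set r := a ^+ 2 + _.
set g := gcdz _ _.
have dvdg m : (m %| g)%Z = [&& (m %| p)%Z, (m %| q)%Z & (m %| r)%Z].
  by rewrite !dvdz_gcd andbA.
have g0 : 0 <= g by [].
have gD : (g %| D)%Z.
  rewrite -(@dvdz_pexp2r _ _ 2) //.
  have -> : D ^+ 2 = - s * p * p + s * q * r.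
    transitivity (s ^+ 2 * D ^+ 2); first by rewrite s2 mul1r.
    by rewrite /D /p /q /r; ring.
  have /and3P[gp gq gr] : [&& (g %| p)%Z, (g %| q)%Z & (g %| r)%Z].
    by rewrite -dvdg dvdzz.
  by rewrite expr2 rpredD // dvdz_mul ?dvdz_mull.
have -> : g = `|D| <-> (D %| g)%Z.
  split=> [-> | Dg]; first by rewrite dvdzE absz_id.
  by apply/eqP; rewrite -[g]ger0_norm // -!abszE eqz_nat eqn_dvd -!dvdzE gD Dg.
by rewrite dvdg; split=> /and3P.
Qed.

(** * Integer matrices exchanging two primitive vectors up to scaling *)

Definition traceless_swap (s a b c d : int) : Prop :=
  exists A : 'M[int]_2, [/\ \det A = s, \tr A = 0,
    exists2 k, k != 0 & maps_to_multiple A a b c d k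
  & exists2 l, l != 0 & maps_to_multiple A c d a b l].

(** Since A^2 = -s, the scaling factors satisfy k l = -s, whence l = 1 or l = -1
and k = - s l.  Solving A v = k w and A w = l v for the entries of A by Cramer's
rule then writes each entry times D as a unit times one of the three numbers to
be divided by D. *)
Lemma traceless_swap_regular s a b c d : s ^+ 2 = 1 ->
  reduced_form a b ->
  traceless_swap s a b c d -> regular s a b c d.
Proof.
move=> s2 [b0 _] [A [detA trA [k k0 [e1 e2]] [l l0 [e3 e4]]]].
move: detA trA e1 e2 e3 e4; rewrite [A]mx22E det_mx22 mxtrace_mx22 !mxE /=.
move: (A 0 0) (A 0 1) (A 1 0) (A 1 1) => x y z t detA trA e1 e2 e3 e4.
have {trA} tE : t = - x by lia.
rewrite {}tE in detA e2 e4.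
(* Compare the second coordinates of A (A v) = k l v and A^2 v = - s v. *)
have kl : k * l = - s.
  apply: (mulIf b0); rewrite -detA.
  transitivity (k * (l * b)); first by ring.
  rewrite -e4.
  transitivity (z * (k * c) + - x * (k * d)); first by ring.
  by rewrite -e1 -e2; ring.
have ll : l * l = 1.
  have : (k * l) ^+ 2 = 1 by rewrite kl sqrrN.
  nia.
have {kl} kE : k = - (s * l).
  by transitivity (k * l * l); [rewrite -mulrA ll mulr1 | rewrite kl; ring].
rewrite {}kE in e1 e2.
apply/regular_dvdz => //.
split; apply/dvdzP; [exists (- l * x) | exists (- l * z) | exists (l * y)].
- transitivity (- l * (- (s * l) * c * d - b * (l * a))); last first.
    by rewrite -e1 -e3; ring.
  by transitivity ((l * l) * (a * b + s * (c * d))); [rewrite ll mul1r|ring].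
- transitivity (- l * (- (s * l) * d * d - b * (l * b))); last first.
    by rewrite -e2 -e4; ring.
  by transitivity ((l * l) * (b ^+ 2 + s * d ^+ 2)); [rewrite ll mul1r|ring].
- transitivity (l * (a * (l * a) - - (s * l) * c * c)); last first.
    by rewrite -e1 -e3; ring.
  by transitivity ((l * l) * (a ^+ 2 + s * c ^+ 2)); [rewrite ll mul1r|ring].
Qed.

(** The conjugate of diag(1, -1) by a matrix of SL_2(Z) with first column
(a, b), the second column coming from a Bezout relation. *)
Lemma traceless_reflection a b : coprimez a b ->
  exists A : 'M[int]_2,
    [/\ \det A = -1, \tr A = 0 & maps_to_multiple A a b a b 1].
Proof.
case/coprimezP=> -[u v] /= uv.
exists (mx22 (u * a - v * b) (2 * a * v) (2 * u * b) (v * b - u * a)).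
rewrite det_mx22 mxtrace_mx22 /maps_to_multiple !mxE /= !mul1r; split.
- by transitivity (- (u * a + v * b) ^+ 2); [ring | rewrite uv].
- by ring.
- split.
  + by transitivity ((u * a + v * b) * a); [ring | rewrite uv mul1r].
  + by transitivity ((u * a + v * b) * b); [ring | rewrite uv mul1r].
Qed.

(** The matrix is 1/D * [ab + s cd, -(a^2 + s c^2); b^2 + s d^2, -(ab + s cd)],
which sends v to s w and w to -v.  For D = 0 divisibility forces s = -1 and w is
v or -v, so the reflection of [traceless_reflection] serves. *)
Lemma regular_traceless_swap s a b c d : s ^+ 2 = 1 ->
  reduced_form a b -> reduced_form c d ->
  regular s a b c d -> traceless_swap s a b c d.
Proof.
move=> s2 [b0 cop] [d0 _] /(regular_dvdz _ _ _ _ _ s2).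
have [D0 | D0] := eqVneq (a * d - b * c) 0.
  rewrite D0 !dvd0z => -[_ /eqP q0 _].
  have sE : s = -1.
    move/eqP: s2; rewrite sqrf_eq1 => /orP[]/eqP sE //.
    by move: q0; rewrite sE; nia.
  have /orP dE : (d == b) || (d == - b) by rewrite -eqf_sqr; subst s; nia.
  have [e ee {}dE] : exists2 e, e * e = 1 & d = e * b.
    by case: dE => /eqP ->; [exists 1 | exists (-1)]; rewrite ?mul1r ?mulN1r.
  have cE : c = e * a.
    apply: (mulfI b0); transitivity (a * d); last by rewrite dE; ring.
    by apply/esym/eqP; rewrite -subr_eq0 D0.
  have e0 : e != 0 by apply: contra_eqN ee => /eqP ->.
  have [A [detA trA [fa fb]]] := traceless_reflection _ _ cop.
  rewrite !mul1r in fa fb.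
  exists A; split; rewrite ?sE //; exists e => //;
    rewrite /maps_to_multiple cE dE.
    by rewrite fa fb !mulrA ee !mul1r.
  by split; [rewrite -[in RHS]fa | rewrite -[in RHS]fb]; ring.
case=> /dvdzP[x xE] /dvdzP[z zE] /dvdzP[y yE].
have s0 : s != 0 by apply: contra_eqN s2 => /eqP ->.
exists (mx22 x (- y) z (- x)); split.
- rewrite det_mx22; apply/(mulfI D0)/(mulfI D0).
  set D := a * d - b * c in xE yE zE *.
  transitivity ((z * D) * (y * D) - (x * D) * (x * D)); first by ring.
  by rewrite -xE -yE -zE /D; ring.
- by rewrite mxtrace_mx22 subrr.
- exists s => //; rewrite /maps_to_multiple !mxE /=.
  set D := a * d - b * c in xE yE zE D0.
  split; apply: (mulIf D0).
    transitivity ((x * D) * a - (y * D) * b); first by ring.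
    by rewrite -xE -yE /D; ring.
  transitivity ((z * D) * a - (x * D) * b); first by ring.
  by rewrite -xE -zE /D; ring.
- exists (-1) => //; rewrite /maps_to_multiple !mxE /=.
  set D := a * d - b * c in xE yE zE D0.
  split; apply: (mulIf D0).
    transitivity ((x * D) * c - (y * D) * d); first by ring.
    by rewrite -xE -yE /D; ring.
  transitivity ((z * D) * c - (x * D) * d); first by ring.
  by rewrite -xE -zE /D; ring.
Qed.

(** * Passage to the projective group *)

Lemma traceless_swap_involution s a b c d : s ^+ 2 = 1 ->
  reduced_form a b -> reduced_form c d ->
  (traceless_swap s a b c d <->
   exists g : PGL2Z, PGL2Z_det g = s /\ involution g /\
     exchanges g (fraction a b) (fraction c d)).
Proof.
move=> s2 hab hcd.
have [b0 _] := hab; have [d0 _] := hcd.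
split=> [[A [detA trA sw1 sw2]] | [g]].
  have uA : A \in unitmx.
    rewrite unitmxE detA; apply/unitrP; exists s.
    by rewrite -expr2.
  exists (\pi_PGL2Z (MkGL2Z uA)); rewrite PGL2Z_detE; split=> //.
  split; first exact/involution_trace.
  by rewrite /exchanges !PGL2Z_actE; split; apply/moebius_fraction.
elim/PGL2Z_ind: g => A; rewrite PGL2Z_detE /exchanges !PGL2Z_actE.
move=> [detA [/involution_trace trA [sw1 sw2]]].
by exists (val A); split=> //; apply/moebius_fraction.
Qed.

Lemma regular_involution s a b c d : s ^+ 2 = 1 ->
  reduced_form a b -> reduced_form c d ->
  (regular s a b c d <->
   exists g : PGL2Z, PGL2Z_det g = s /\ involution g /\
     exchanges g (fraction a b) (fraction c d)).
Proof.
move=> s2 hab hcd; rewrite -traceless_swap_involution //; split.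
  exact: regular_traceless_swap.
exact: traceless_swap_regular.
Qed.

Theorem theorem5p11 (a b c d : int) (hab : reduced_form a b)
    (hcd : reduced_form c d) :
  (inner_regular a b c d <->
     exists g : PGL2Z, orientation_preserving g /\ involution g /\
       exchanges g (fraction a b) (fraction c d)) /\
  (outer_regular a b c d <->
     exists g : PGL2Z, orientation_reversing g /\ involution g /\
       exchanges g (fraction a b) (fraction c d)).
Proof.
split.
  rewrite -(@regular_involution 1) ?expr1n // /regular /inner_regular.
  by rewrite !mul1r.
rewrite -(@regular_involution (-1)) ?sqrrN ?expr1n // /regular /outer_regular.
by rewrite !mulN1r.
Qed.
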